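(* Let $A$ be a unital Banach algebra with identity element $I$, and let $(C(t))_{t\in\mathbb{R}}$ be a cosine family in $A$. If $\limsup_{t\to\infty}\|C(t)-I\|<2$, then $C(t)=I$ for all $t\in\mathbb{R}$.
   Context: A cosine family in a unital algebra $A$ with identity element $I$ is a family $(C(t))_{t\in\mathbb{R}}$ of elements of $A$ such that $C(0)=I$ and $C(t+s)+C(t-s)=2C(t)C(s)$ for all $s,t\in\mathbb{R}$ (d'Alembert's identity). No continuity in $t$ is assumed. *)

(* Defs.v *)
From HB Require Import structures.
From mathcomp Require Import all_boot all_order all_algebra.
From mathcomp Require Import all_classical all_reals all_analysis.

Set Implicit Arguments.
Unset Strict Implicit.
Unset Printing Implicit Defensive.
Import Order.TTheory GRing.Theory Num.Theory.
Import numFieldNormedType.Exports.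
Local Open Scope classical_set_scope.
Local Open Scope ring_scope.

(* Hierarchy-Builder rejects the join of GRing.Algebra with NormedModule (no
   common structure was declared below Num.NumDomain), so the product and the
   identity are fields of the mixin instead of the ring operations.
   Neither bone != 0 nor `|bone| = 1 is imposed: both conventions for the norm
   of the identity are covered. *)
HB.mixin Record isBanachAlgebra (K : numFieldType) A
    of CompleteNormedModule K A := {
  bone : A;
  bmul : A -> A -> A;
  bmulA : associative bmul;
  bmul1l : left_id bone bmul;
  bmul1r : right_id bone bmul;
  bmulDl : left_distributive bmul +%R;
  bmulDr : right_distributive bmul +%R;
  bscaleAl : forall (k : K) (x y : A), k *: bmul x y = bmul (k *: x) y;
  bscaleAr : forall (k : K) (x y : A), k *: bmul x y = bmul x (k *: y);
  normr_bmul_le : forall x y : A, `|bmul x y| <= `|x| * `|y|;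
}.

#[short(type="banachAlgType")]
HB.structure Definition BanachAlgebra (K : numFieldType) :=
  {A of CompleteNormedModule K A & isBanachAlgebra K A}.

Definition cosine_family (R : realType) (K : numFieldType)
    (A : banachAlgType K) (C : R -> A) : Prop :=
  C 0 = bone /\
  forall s t : R, C (t + s) + C (t - s) = 2%:R *: bmul (C t) (C s).

(* Main.v *)
From HB Require Import structures.
Require Import Defs.
From mathcomp Require Import all_boot all_order all_algebra.
From mathcomp Require Import all_classical all_reals all_analysis.
From mathcomp Require Import ring lra zify.
From mathcomp.real_closed Require Import complex.

(** Suppose first that the algebra is the field of complex numbers. A bounded
    scalar cosine family is C t = cos (x t) with x (n t) = n (x t) modulo 2 pi.
    The hypothesis says that, for t large, every multiple n (x t), n > 0, stays
    at a fixed distance from pi. The multiples of an angle can do so only if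
    they form a finite group of odd order, and the distance to pi bounds that
    order. Hence a single M > 0 satisfies cos (M (x t)) = 1 for all large t, so
    C s = 1 for all large s, and d'Alembert's identity propagates this to every
    real number.

    In a Banach algebra the same argument is run on spectral radii, without
    spectra. The supply of functions of C t is the real trigonometric
    polynomials: sum_n c_n cos (n x) acts as sum_n c_n C (n t). Three facts
    replace the Gelfand transform.
    - Interpolation at equally spaced nodes bounds the norm of the element
      attached to f by a constant times deg f + 1 times the supremum of |f|.
      Applied to the powers of f, whose degrees grow only linearly, it bounds
      the spectral radius by the supremum ([trig_power_bound]).
    - If ||C s - 1|| <= c < 2, then ||(1 + C s) z|| >= (2 - c) ||z|| for all z,
      so multiplication by 1 + C s can be cancelled in such estimates. Therefore
      the element attached to f has a small spectral radius when f is
      concentrated where 1 + cos (n x) is small ([trig_power_bound_cancel]).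
    - By Dirichlet's approximation theorem there are M and m such that every
      angle x either satisfies 1 - cos (M x) <= 1/2 or has a multiple n x with
      0 < n <= m very close to pi ([return_or_antipode]).
    Cutting 1 - cos (M x) off near the antipodal angles costs little spectral
    radius by the second fact, and leaves a function with values in [0, 1/2].
    So 1 - C (M t) has bounded powers for every large t
    ([return_power_bound], [cosine_return]).

    It remains to pass from powers to norms. The element a = 1 - C s solves
    a = (X + a ^ 2) / 2 with X = (1 - C (2 s)) / 2. Iterating this equation from
    0 stays in the ball of radius ||X|| < 1, and bounded powers of a make the
    iteration converge to a ([logistic_contract]). Thus
    ||1 - C s|| <= ||1 - C (2 s)|| / 2 for all large s, which forces C s = 1. *)

Set Implicit Arguments.
Unset Strict Implicit.
Unset Printing Implicit Defensive.
Import Order.TTheory GRing.Theory Num.Theory.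
Import numFieldNormedType.Exports.
Local Open Scope classical_set_scope.
Local Open Scope ring_scope.

(** * Cosines at equally spaced nodes *)

Section RealFunctions.
Variable R : realType.
Implicit Types x y t : R.

Lemma cosM_prod x y : cos x * cos y = 2^-1 * (cos (x + y) + cos (x - y)).
Proof. by rewrite cosD cosB; field. Qed.

Lemma sin_nat_pi_neq0 (N m : nat) :
  (0 < N)%N -> ~~ (N %| m)%N -> sin (m%:R * (pi / N%:R)) != 0 :> R.
Proof.
move=> N0 Nm; have NR : N%:R != 0 :> R by rewrite pnatr_eq0 -lt0n.
have r0 : (0 < m %% N)%N by rewrite lt0n.
have -> : m%:R * (pi / N%:R) = (m %% N)%:R * (pi / N%:R) + pi *+ (m %/ N) :> R.
  by rewrite [in LHS](divn_eq m N) natrD natrM -mulr_natr; field.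
rewrite alternatingn; last exact: sinDpi.
rewrite mulf_neq0 ?signr_eq0//; apply/lt0r_neq0/sin_gt0_pi.
rewrite mulr_gt0 ?divr_gt0 ?pi_gt0 ?ltr0n//=.
rewrite mulrCA -[ltRHS]mulr1 ltr_pM2l ?pi_gt0// ltr_pdivrMr ?ltr0n// mul1r.
by rewrite ltr_nat ltn_mod.
Qed.

(** When [N] does not divide [m], multiplication by [2 sin (m pi / N)] makes the
    sum telescope. *)
Lemma sum_cos_roots (N m : nat) : (0 < N)%N ->
  \sum_(l < N) cos (m%:R * (l%:R * (pi *+ 2 / N%:R))) =
  (if (N %| m)%N then N%:R else 0 : R).
Proof.
move=> N0; have NR : N%:R != 0 :> R by rewrite pnatr_eq0 -lt0n.
case: ifPn => [/dvdnP[q ->]|Nm].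
  rewrite (eq_bigr (fun=> 1)) ?sumr_const ?card_ord// => l _.
  have -> : (q * N)%:R * (l%:R * (pi *+ 2 / N%:R)) = 0 + (pi *+ 2) *+ (q * l) :> R.
    by rewrite !natrM -[(_ *+ 2) *+ (q * l)]mulr_natr natrM; field.
  by rewrite periodicn ?cos0//; exact: cosD2pi.
set h : R := m%:R * (pi / N%:R).
have h0 : 2 * sin h != 0 by rewrite mulf_neq0// sin_nat_pi_neq0.
apply: (mulfI h0); rewrite mulr0 mulr_sumr.
pose g (l : nat) := sin (l%:R * (h *+ 2) - h).
rewrite -(big_mkord xpredT (fun l => 2 * sin h *
  cos (m%:R * (l%:R * (pi *+ 2 / N%:R))))).
rewrite (eq_bigr (fun l : nat => g l.+1 - g l)); last first.
  move=> l _; rewrite /g.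
  have -> : m%:R * (l%:R * (pi *+ 2 / N%:R)) = l%:R * (h *+ 2) :> R.
    by rewrite /h; ring.
  have -> : l.+1%:R * (h *+ 2) - h = l%:R * (h *+ 2) + h :> R.
    by rewrite -natr1; ring.
  by rewrite sinD sinB; ring.
rewrite telescope_sumr// /g mul0r add0r.
have -> : N%:R * (h *+ 2) - h = - h + (pi *+ 2) *+ m :> R.
  by rewrite /h -[(_ *+ 2) *+ m]mulr_natr; field.
by rewrite periodicn ?subrr//; exact: sinD2pi.
Qed.

Definition node (d l : nat) : R := l%:R * (pi *+ 2 / (2 * d).+1%:R).

(** The factor that makes the functions [cos (j x)], [j <= d], dual to
    themselves for the average over the nodes: the constant function has twice
    the mean square of the others. *)
Definition weight (j : nat) : R := if j == 0%N then 1 else 2.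

Lemma cos_nodes_orth (d n j : nat) : (n <= d)%N -> (j <= d)%N ->
  \sum_(l < (2 * d).+1) weight j * (cos (n%:R * node d l) * cos (j%:R * node d l)) =
  (if j == n then (2 * d).+1%:R else 0).
Proof.
move=> nd jd; rewrite -mulr_sumr.
under eq_bigr => l _.
  rewrite cosM_prod -mulrDl -natrD.
  have -> : cos (n%:R * node d l - j%:R * node d l) =
    cos (((n - j) + (j - n))%:R * node d l).
    rewrite -mulrBl; have [le|/ltnW le] := leqP n j.
      by rewrite (eqP le) add0n natrB// -cosN -mulNr opprB.
    by rewrite (eqP le) addn0 natrB.
  over.
rewrite -mulr_sumr big_split/= !sum_cos_roots// /weight.
have -> : ((2 * d).+1 %| n + j)%N = (n + j == 0)%N.
  apply/idP/eqP => [/dvdnP[[|q] qE]|->]; first [exact: dvdn0 | nia].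
have -> : ((2 * d).+1 %| n - j + (j - n))%N = (j == n).
  apply/idP/eqP => [/dvdnP[[|q] qE]|->]; first [by rewrite subnn | nia].
rewrite addn_eq0.
have [->|jn] := eqVneq j n.
  have [_|_] /= := eqVneq n 0%N; last by field.
  by field.
have [n0|n0] /= := eqVneq n 0%N.
  by rewrite n0 in jn; rewrite (negbTE jn) addr0 !mulr0.
by rewrite addr0 !mulr0.
Qed.

(** * Multiples of an angle *)

(** Pigeonhole: of the [Q + 1] fractional parts of [i * tau], two lie in the same
    interval of length [1 / Q]. *)
Lemma dirichlet (Q : nat) (tau : R) : (0 < Q)%N ->
  exists (q : nat) (p : int), [/\ (0 < q)%N, (q <= Q)%N &
    `|q%:R * tau - p%:~R| < Q%:R^-1].
Proof.
move=> Q0; have QR : 0 < Q%:R :> R by rewrite ltr0n.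
pose fr (i : nat) : R := i%:R * tau - (Num.floor (i%:R * tau))%:~R.
have fr0 i : 0 <= fr i by rewrite subr_ge0 floor_le.
have fr1 i : fr i < 1 by rewrite ltrBlDl -intrD1 floorD1_gt.
have boxlt i : (Num.truncn (Q%:R * fr i) < Q)%N.
  rewrite truncn_lt_nat ?mulr_ge0 ?ler0n//.
  by rewrite -[ltRHS]mulr1 ltr_pM2l.
pose box (i : 'I_Q.+1) : 'I_Q := Ordinal (boxlt i).
have [i [j [ij eqb]]] : exists i j : 'I_Q.+1, (i < j)%N /\ box i = box j.
  have /injectivePn[i [j ij e]] : ~~ injectiveb box.
    apply/negP => /injectiveP/leq_card; rewrite !card_ord; lia.
  have [lt|] := ltnP i j; first by exists i, j.
  rewrite leq_eqVlt => /orP[/eqP e2|lt]; last by exists j, i.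
  by move: ij; rewrite -val_eqE/= e2 eqxx.
exists (j - i)%N, (Num.floor (j%:R * tau) - Num.floor (i%:R * tau)).
split; [lia|have := ltn_ord j; lia|].
rewrite natrB ?(ltnW ij)// mulrBl intrB.
have -> : j%:R * tau - i%:R * tau - ((Num.floor (j%:R * tau))%:~R -
   (Num.floor (i%:R * tau))%:~R) = fr j - fr i by rewrite /fr; ring.
have /(congr1 val)/= eqb' := eqb.
have bi : (Num.truncn (Q%:R * fr i))%:R <= Q%:R * fr i < (Num.truncn (Q%:R * fr i)).+1%:R.
  by apply: truncn_itv; rewrite mulr_ge0// ler0n.
have bj : (Num.truncn (Q%:R * fr j))%:R <= Q%:R * fr j < (Num.truncn (Q%:R * fr j)).+1%:R.
  by apply: truncn_itv; rewrite mulr_ge0// ler0n.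
rewrite -eqb' in bj; move: bi bj; rewrite -natr1.
set b := (_%:R) => /andP[b1 b2] /andP[b3 b4].
rewrite -(ltr_pM2l QR) mulfV ?gt_eqF// -[X in X * `| _ |](gtr0_norm QR) -normrM.
rewrite mulrBr ltr_norml; apply/andP; split; lra.
Qed.

Lemma cosD_int2pi x (p : int) : cos (x + p%:~R * (pi *+ 2)) = cos x.
Proof.
case: p => p.
  by rewrite -[_%:~R]/(p%:R) mulr_natl periodicn//; exact: cosD2pi.
rewrite NegzE mulrNz -pmulrn mulNr mulr_natl.
by have := periodicn (@cosD2pi R) p.+1 (x - pi *+ 2 *+ p.+1); rewrite subrK.
Qed.

Lemma one_sub_cos_small (e : R) : 0 < e ->
  exists2 h : R, 0 < h & forall x, `|x| < h -> 1 - cos x <= e.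
Proof.
move=> e0; have /cvgrPdist_lt/(_ _ e0) := @continuous_cos R 0.
move=> /nbhs_ballP[h/= h0 H]; exists h => // x xh.
have := H x; rewrite /ball/= sub0r normrN => /(_ xh).
by rewrite cos0 => /ltW; exact: le_trans (ler_norm _).
Qed.

(** Dirichlet's theorem gives a multiple [q * x], [0 < q <= Q], within [2 pi / Q]
    of [0]. If it is extremely close to [0], then so is [Q! * x]. Otherwise its
    multiples advance by steps that are short but bounded below, so that one of
    them passes close to [pi] after a bounded number of steps. *)
Lemma return_or_antipode (e : R) : 0 < e ->
  exists2 M, (0 < M)%N & exists N, forall x, 1 - cos (M%:R * x) <= 2^-1 \/
    exists n : nat, [/\ (0 < n)%N, (n <= N)%N & 1 + cos (n%:R * x) <= e].
Proof.
move=> e0; have [h h0 Hh] := one_sub_cos_small e0.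
have [k k0 Hk] : exists2 k : R, 0 < k & forall x, `|x| < k -> 1 - cos x <= 2^-1.
  by apply: one_sub_cos_small; rewrite invr_gt0.
have p0 := pi_gt0 R.
(* [Q >= 2] leaves room for at least one step before reaching [pi]. *)
pose Q := (Num.truncn (2 * pi / h)).+2.
have Qh : 2 * pi < h * Q%:R.
  rewrite [ltRHS]mulrC -ltr_pdivrMr//.
  by apply: (lt_le_trans (truncnS_gt _)); rewrite ler_nat.
have QR : 2 <= Q%:R :> R by rewrite ler_nat.
pose M := Q`!; have MR : 0 < M%:R :> R by rewrite ltr0n fact_gt0.
(* Below the threshold [K], in units of a full turn, multiplying by [M] still
   leaves an angle less than [k]. *)
pose K := k / (2 * pi * M%:R); have K0 : 0 < K by rewrite divr_gt0 ?mulr_gt0.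
exists M; first exact: fact_gt0.
exists (Num.truncn (2 * K)^-1 * Q)%N => x.
have [q [p [q0 qQ]]] := @dirichlet Q (x / (2 * pi)) isT.
set a := (_ - _) => aQ.
have qx : q%:R * x = 2 * pi * a + p%:~R * (pi *+ 2).
  have F (P : R) : P != 0 -> q%:R * x =
      2 * P * (q%:R * (x / (2 * P)) - p%:~R) + p%:~R * (P *+ 2).
    by move=> P0; field.
  by apply: F; rewrite gt_eqF.
have [aK|Ka] := ltP `|a| K; [left|right].
  have [m mE] : exists m, M = (m * q)%N.
    have /dvdnP[m ->] : (q %| M)%N by rewrite dvdn_fact// q0.
    by exists m.
  have -> : M%:R * x = m%:R * (2 * pi * a) + (m%:Z * p)%:~R * (pi *+ 2).
    by rewrite mE natrM -mulrA qx intrM; ring.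
  rewrite cosD_int2pi; apply: Hk.
  rewrite !normrM !normr_nat (gtr0_norm p0).
  have : m%:R <= M%:R :> R by rewrite ler_nat mE leq_pmulr.
  move=> mM; have : `|a| * (2 * pi * M%:R) < k by rewrite -ltr_pdivlMr ?mulr_gt0.
  apply: le_lt_trans.
  have : m%:R * (2 * pi * `|a|) <= M%:R * (2 * pi * `|a|).
    by rewrite ler_wpM2r// !mulr_ge0// ltW.
  lra.
have a0 : 0 < `|a| by apply: lt_le_trans Ka.
have aa0 : 0 < 2 * `|a| by rewrite mulr_gt0.
(* The last multiple of [2 pi |a|] that does not exceed [pi]. *)
set n := Num.truncn (2 * `|a|)^-1.
have /andP[n1 n2] : n%:R <= (2 * `|a|)^-1 < n.+1%:R.
  by apply: truncn_itv; rewrite invr_ge0 ltW.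
have {}n1 : n%:R * (2 * `|a|) <= 1 by rewrite -ler_pdivlMr// mul1r.
have {}n2 : 1 < n.+1%:R * (2 * `|a|) by rewrite -ltr_pdivrMr// mul1r.
have aQ' : `|a| * Q%:R < 1 by rewrite -ltr_pdivlMr ?mul1r// (lt_le_trans _ QR).
have n0 : (0 < n)%N.
  rewrite lt0n; apply/eqP => nE; move: n2; rewrite nE mul1r.
  have : `|a| * 2 <= `|a| * Q%:R by rewrite ler_wpM2l.
  lra.
exists (n * q)%N; split.
- by rewrite muln_gt0 n0.
- have K2 : 0 < 2 * K by exact: mulr_gt0.
  rewrite leq_mul// le_truncn// lef_pV2 ?posrE//.
  by rewrite ler_pM2l.
have -> : (n * q)%:R * x = n%:R * (2 * pi * a) + (n%:Z * p)%:~R * (pi *+ 2).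
  by rewrite natrM -mulrA qx intrM; ring.
rewrite cosD_int2pi -cos_norm.
have -> : `|n%:R * (2 * pi * a)| = - (pi - n%:R * (2 * `|a|) * pi) + pi.
  by rewrite !normrM !normr_nat (gtr0_norm p0); ring.
rewrite cosDpi cosN; apply: Hh.
rewrite -natr1 in n2.
rewrite ger0_norm; last first.
  by rewrite subr_ge0 -[leRHS]mul1r ler_wpM2r// ltW.
have H1 : pi < (n%:R + 1) * (2 * `|a|) * pi by rewrite -[ltLHS]mul1r ltr_pM2r.
have H2 : 2 * pi * (`|a| * Q%:R) < 2 * pi * 1 by rewrite ltr_pM2l ?mulr_gt0.
have H3 : 2 * pi * `|a| * Q%:R < h * Q%:R by lra.
have : 2 * pi * `|a| < h by rewrite -(ltr_pM2r (lt_le_trans _ QR)).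
lra.
Qed.

(** * A polynomial cut-off *)

Lemma expr_small (r e : R) : 0 <= r < 1 -> 0 < e -> exists n, r ^+ n <= e.
Proof.
move=> /andP[r0 r1] e0.
have : (fun n => r ^+ n) @ \oo --> (0 : R) by apply: cvg_expr; rewrite ger0_norm.
move=> /cvgrPdist_le/(_ _ e0)[n _ /(_ n (leqnn n))]; rewrite sub0r normrN => H.
by exists n; apply: le_trans H; exact: ler_norm.
Qed.

Lemma bernoulli_one_add (h : R) k : 0 <= h -> 1 + k%:R * h <= (1 + h) ^+ k.
Proof.
move=> h0; elim: k => [|k IH]; first by rewrite mul0r addr0 expr0.
have kh : 0 <= k%:R * h by rewrite mulr_ge0.
have : (1 + h) * (1 + k%:R * h) <= (1 + h) * (1 + h) ^+ k by rewrite ler_wpM2l//; lra.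
rewrite exprS -natr1; nra.
Qed.

Lemma bernoulli_one_sub (b : R) n : 0 <= b <= 1 -> 1 - n%:R * b <= (1 - b) ^+ n.
Proof.
move=> /andP[b0 b1]; elim: n => [|n IH]; first by rewrite mul0r subr0 expr0.
have nb : 0 <= n%:R * b by rewrite mulr_ge0.
have : (1 - b) * (1 - n%:R * b) <= (1 - b) * (1 - b) ^+ n.
  by rewrite ler_wpM2l// subr_ge0.
rewrite exprS -natr1; nra.
Qed.

Lemma bernoulli_one_sub_inv (b : R) n :
  0 <= b <= 1 -> (1 - b) ^+ n * (1 + n%:R * b) <= 1.
Proof.
move=> /andP[b0 b1]; elim: n => [|n IH]; first by rewrite mul0r addr0 expr0 mulr1.
apply: le_trans IH; rewrite exprSr -mulrA ler_wpM2l ?exprn_ge0 ?subr_ge0//.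
have nb : 0 <= n%:R * b by rewrite mulr_ge0.
rewrite -natr1; nra.
Qed.

(** For suitable exponents this polynomial is close to [1] near [y = -1] and
    close to [0] away from it on [-1, 1]: the inner power decays geometrically
    in [L] at a rate that increases with [y], and the outer power sends its
    relatively large values near [1] and its relatively small ones near [0]. *)
Definition plateau (L L' : nat) (y : R) := 1 - (1 - ((1 - y) / 2) ^+ L) ^+ L'.

(** The last bound pays for the cancellation of [j] factors [1 + y], each at the
    price [1 / d]. Where [1 + y <= d / 2] this comes from [2 ^- j] alone.
    Elsewhere the cut-off itself has to beat [(2 / d) ^ j], which is why [j] is
    fixed before [L]. *)
Lemma plateauP (d e : R) : 0 < d <= 2 -> 0 < e ->
  exists L L' j, forall y, -1 <= y <= 1 ->
  [/\ 0 <= plateau L L' y <= 1,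
      1 + y <= d / 4 -> 1 - plateau L L' y <= 4^-1 &
      plateau L L' y * (1 + y) ^+ j <= e * d ^+ j].
Proof.
move=> /andP[d0 d2] e0.
have [j je] : exists j, (2^-1 : R) ^+ j <= e by apply: expr_small => //; lra.
have c0 : 0 < 1 - d / 8 by lra.
(* Ratio of the inner bases at [1 + y = d / 2] and [1 + y = d / 4]: the inner
   power separates these two points by the factor [r ^ L]. *)
set r := (1 - d / 4) / (1 - d / 8).
have rr : 0 <= r < 1.
  by rewrite /r divr_ge0 ?ltW//=; [rewrite ltr_pdivrMr//; lra|lra].
have [L Le] : exists L, r ^+ L <= e / 4 * (d / 2) ^+ j.
  by apply: expr_small => //; rewrite mulr_gt0 ?exprn_gt0 ?divr_gt0.
set a := (1 - d / 8) ^+ L; have a0 : 0 < a by rewrite exprn_gt0.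
have a1 : a <= 1 by rewrite exprn_ile1//; lra.
(* [L' * a] lies between [3] and [4]: enough for [1 - plateau <= 1 / 4] on one
   side, and [plateau <= 4 * r ^ L] on the other. *)
set L' := (Num.truncn (3 / a)).+1.
have /andP[l1 l2] : (Num.truncn (3 / a))%:R <= 3 / a < L'%:R.
  by apply: truncn_itv; rewrite divr_ge0// ltW.
have {}l1 : L'%:R * a <= 4.
  rewrite /L' -natr1 mulrDl mul1r.
  have : (Num.truncn (3 / a))%:R * a <= 3 by rewrite -ler_pdivlMr.
  lra.
have {}l2 : 3 < L'%:R * a by rewrite -ltr_pdivrMr.
exists L, L', j => y /andP[y1 y2]; rewrite /plateau.
have w0 : 0 <= (1 - y) / 2 by lra.
have w1 : (1 - y) / 2 <= 1 by lra.
set b := ((1 - y) / 2) ^+ L.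
have b0 : 0 <= b by rewrite exprn_ge0.
have b1 : b <= 1 by rewrite exprn_ile1.
have bb : 0 <= b <= 1 by rewrite b0.
have c1 : (1 - b) ^+ L' <= 1 by rewrite exprn_ile1//; lra.
have c2 : 0 <= (1 - b) ^+ L' by rewrite exprn_ge0//; lra.
split; first lra.
- move=> yd; have ab : a <= b by rewrite lerXn2r ?nnegrE//; lra.
  have := bernoulli_one_sub_inv L' bb; set z := (1 - b) ^+ L' in c1 c2 *.
  have : L'%:R * a <= L'%:R * b by rewrite ler_wpM2l.
  move=> lb H; have : z * 4 <= z * (1 + L'%:R * b) by rewrite ler_wpM2l//; lra.
  lra.
have [yd|yd] := leP (1 + y) (d / 2).
  apply: (@le_trans _ _ (1 * (d / 2) ^+ j)).
    apply: ler_pM; rewrite ?exprn_ge0//; try lra.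
    by rewrite lerXn2r ?nnegrE//; lra.
  rewrite mul1r exprMn mulrC.
  by apply: ler_wpM2r je; rewrite exprn_ge0// ltW.
apply: (@le_trans _ _ ((4 * r ^+ L) * 2 ^+ j)).
  apply: ler_pM; rewrite ?exprn_ge0//; try lra; last first.
    by rewrite lerXn2r ?nnegrE//; lra.
  have := bernoulli_one_sub L' bb => H.
  have H2 : b <= (1 - d / 4) ^+ L by rewrite lerXn2r ?nnegrE//; lra.
  have H3 : (1 - d / 4) ^+ L = r ^+ L * a.
    by rewrite /a -exprMn /r divfK// gt_eqF.
  have H4 : L'%:R * b <= L'%:R * (r ^+ L * a) by rewrite -H3 ler_wpM2l.
  have H5 : r ^+ L * (L'%:R * a) <= r ^+ L * 4.
    by rewrite ler_wpM2l// exprn_ge0//; case/andP: rr.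
  lra.
have -> : e * d ^+ j = 4 * (e / 4 * (d / 2) ^+ j) * 2 ^+ j.
  by rewrite -mulrA -mulrA -exprMn divfK//; field.
by rewrite ler_wpM2r ?exprn_ge0// ler_wpM2l.
Qed.

End RealFunctions.

(** * Power bounds in a normed ring *)

(** A real normed algebra is presented as a ring with a central copy [iota] of the
    real numbers, so that real and complex scalars are treated at once. *)
Section NormedRing.
Variables (R : realType) (A : pzRingType) (iota : {rmorphism R -> A}).
Variable N : A -> R.
Hypothesis iotaC : forall r a, iota r * a = a * iota r.
Hypothesis ND : forall a b, N (a + b) <= N a + N b.
Hypothesis NM : forall a b, N (a * b) <= N a * N b.
Hypothesis NZ : forall r a, N (iota r * a) = `|r| * N a.
Hypothesis N_eq0 : forall a, N a = 0 -> a = 0.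

Implicit Types (a b : A) (r s : R).

Lemma N0 : N 0 = 0.
Proof. by rewrite -(mulr0 (iota 0)) NZ normr0 mul0r. Qed.

Lemma NN a : N (- a) = N a.
Proof. by rewrite -mulN1r -(rmorphN1 iota) NZ normrN1 mul1r. Qed.

Lemma N_ge0 a : 0 <= N a.
Proof. by have := ND a (- a); rewrite subrr N0 NN; lra. Qed.

Lemma N_sum (I : Type) (l : seq I) (F : I -> A) :
  N (\sum_(i <- l) F i) <= \sum_(i <- l) N (F i).
Proof.
elim: l => [|i l IH]; first by rewrite !big_nil N0.
by rewrite !big_cons (le_trans (ND _ _))// lerD2l.
Qed.

Lemma iota_comm r a : GRing.comm (iota r) a.
Proof. exact: iotaC. Qed.

Lemma iotaK2 : iota 2^-1 * 2%:R = 1.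
Proof. by rewrite -(rmorph_nat iota) -rmorphM mulVf// rmorph1. Qed.

(** Up to an arbitrarily small increase of [r], this says that the spectral radius
    of [a] is at most [r]. *)
Definition power_bound a r := exists B, forall k, N (a ^+ k) <= B * r ^+ k.

Lemma power_bound_nneg a r : 0 <= r -> power_bound a r ->
  exists2 B, 0 <= B & forall k, N (a ^+ k) <= B * r ^+ k.
Proof.
move=> r0 [B HB]; exists `|B| => // k; apply: le_trans (HB k) _.
by rewrite ler_wpM2r ?exprn_ge0// ler_norm.
Qed.

Lemma power_bound_le a r s : 0 <= r <= s -> power_bound a r -> power_bound a s.
Proof.
move=> /andP[r0 rs] /(power_bound_nneg r0)[B B0 HB]; exists B => k.
by rewrite (le_trans (HB k))// ler_wpM2l// lerXn2r// nnegrE// (le_trans r0).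
Qed.

(** Expanding one factor [a + b] at a time turns it into a further [a] or a further
    [b]; carrying the monomial [a ^ i * b ^ j] along makes the induction work. *)
Lemma power_boundD a b r s : GRing.comm a b -> 0 <= r -> 0 <= s ->
  power_bound a r -> power_bound b s -> power_bound (a + b) (r + s).
Proof.
move=> ab r0 s0 /(power_bound_nneg r0)[B B0 HB] /(power_bound_nneg s0)[D D0 HD].
suff H k : forall i j,
    N (a ^+ i * b ^+ j * (a + b) ^+ k) <= B * D * (r ^+ i * s ^+ j) * (r + s) ^+ k.
  exists (B * D) => k; have := H k 0%N 0%N.
  by rewrite !expr0 !mul1r !mulr1.
elim: k => [i j|k IH i j].
  rewrite !expr0 !mulr1 (le_trans (NM _ _))// mulrACA.
  by apply: ler_pM; rewrite ?N_ge0.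
have -> : a ^+ i * b ^+ j * (a + b) ^+ k.+1 =
    a ^+ i.+1 * b ^+ j * (a + b) ^+ k + a ^+ i * b ^+ j.+1 * (a + b) ^+ k.
  rewrite [in LHS]exprS mulrA mulrDr mulrDl; congr (_ * _ + _ * _).
    by rewrite -mulrA -(commrX j ab) mulrA -exprSr.
  by rewrite -mulrA -exprSr.
apply: le_trans (ND _ _) _.
apply: le_trans (lerD (IH _ _) (IH _ _)) _.
rewrite le_eqVlt; apply/orP; left; apply/eqP.
by rewrite !exprS; ring.
Qed.

(** An element [g] that is bounded below can be cancelled as if it had an inverse
    of norm at most [1 / d]. *)
Lemma power_bound_cancel (g a : A) (d r : R) j : 0 < d -> GRing.comm g a ->
  (forall z, d * N z <= N (g * z)) ->
  power_bound (a * g ^+ j) (r * d ^+ j) -> power_bound a r.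
Proof.
move=> d0 ga low [B HB]; exists B => k.
have lowX i z : d ^+ i * N z <= N (g ^+ i * z).
  elim: i z => [|i IH] z; first by rewrite !expr0 !mul1r.
  rewrite exprS -mulrA exprS -mulrA (le_trans _ (low _))//.
  by rewrite ler_wpM2l ?IH// ltW.
rewrite -(ler_pM2l (exprn_gt0 (j * k) d0)); apply: le_trans (lowX _ _) _.
have -> : g ^+ (j * k) * a ^+ k = (a * g ^+ j) ^+ k.
  rewrite exprMn_comm; last exact/commrX/commr_sym.
  by rewrite -exprM; apply/commrX/commr_sym/commrX/commr_sym.
by rewrite (le_trans (HB k))// exprMn -exprM mulrA mulrC.
Qed.

(** With [X = a *+ 2 - a ^ 2] the element [a] is a fixed point of
    [y |-> (X + y ^ 2) / 2]. The iterates [B k] of [0] stay in the ball of radius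
    [b], and [a - B k] is the product of [a] and of the factors [(a + B j) / 2],
    [j < k]. The product of the numerators grows at most like [(1 + b) ^ k], and
    [(1 + b) / 2 < 1], so that [a] is a limit of the [B k]. *)
Lemma logistic_contract a (b : R) : power_bound a 1 ->
  N (a *+ 2 - a ^+ 2) <= b -> b < 1 -> N a <= b.
Proof.
move=> /(power_bound_nneg ler01)[D D0 HD].
set X := (_ - _) => Xb b1; have b0 : 0 <= b := le_trans (N_ge0 _) Xb.
pose B k : A := iter k (fun y => iota 2^-1 * (X + y ^+ 2)) 0.
have aX : GRing.comm a X by apply: commrB; [exact: commrMn|exact: commrX].
have aB k : GRing.comm a (B k).
  elim: k => [|k IH]; first exact: commr0.
  apply: commrM; first exact/commr_sym/iota_comm.
  by apply: commrD => //; exact: commrX.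
have NB k : N (B k) <= b.
  elim: k => [|k IH]; first by rewrite /B/= N0.
  rewrite /= NZ ger0_norm ?invr_ge0//.
  have := ND X (B k ^+ 2); have := NM (B k) (B k); have := N_ge0 (B k).
  rewrite -expr2; set n := N (B k) in IH *; nra.
pose P k : A := \prod_(j < k) (a + B j).
have PS k : P k.+1 = P k * (a + B k) by rewrite /P big_ord_recr.
have NP k : forall i, N (a ^+ i * P k) <= D * (1 + b) ^+ k.
  elim: k => [i|k IH i].
    by rewrite /P big_ord0 mulr1 expr0 (le_trans (HD _))// expr1n.
  rewrite PS mulrDr mulrDr; apply: le_trans (ND _ _) _.
  rewrite exprS mulrDl mul1r mulrDr; apply: lerD.
    have -> : a ^+ i * (P k * a) = a ^+ i.+1 * P k.
      rewrite exprSr -mulrA; congr (_ * _); apply: commr_sym.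
      by apply: commr_prod => j _; apply: commrD.
    exact: IH.
  rewrite mulrA (le_trans (NM _ _))// mulrCA mulrC ler_pM// ?N_ge0//.
have E k : a - B k = iota (2^-1 ^+ k) * (a * P k).
  elim: k => [|k IH]; first by rewrite /B/= subr0 expr0 rmorph1 mul1r /P big_ord0 mulr1.
  have -> : a - B k.+1 = iota 2^-1 * ((a - B k) * (a + B k)).
    have -> : (a - B k) * (a + B k) = a *+ 2 - (X + B k ^+ 2).
      rewrite /X opprD opprB addrA [a *+ 2 + _]addrC subrK !expr2.
      by rewrite mulrDr !mulrBl -aB addrA subrK.
    by rewrite [RHS]mulrBr -[a *+ 2]mulr_natl mulrA iotaK2 mul1r.
  by rewrite IH exprS rmorphM PS !mulrA.
apply/ler_addgt0Pr => e e0.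
have [k kE] : exists k, (2^-1 * (1 + b)) ^+ k <= e / (D + 1).
  apply: expr_small; last by rewrite divr_gt0//; lra.
  lra.
rewrite -(subrK (B k) a) addrC (le_trans (ND _ _))// lerD// E NZ.
rewrite ger0_norm ?exprn_ge0 ?invr_ge0//.
have := NP k 1%N; rewrite expr1 => H.
have H2 : 2^-1 ^+ k * N (a * P k) <= 2^-1 ^+ k * (D * (1 + b) ^+ k).
  by rewrite ler_wpM2l// exprn_ge0// invr_ge0.
apply: le_trans H2 _; rewrite mulrCA -exprMn.
apply: le_trans (ler_wpM2l D0 kE) _.
rewrite mulrCA -[leRHS]mulr1 ler_wpM2l ?(ltW e0)// ler_pdivrMr; lra.
Qed.

(** * Trigonometric polynomials of a cosine sequence *)

Section CosineSequence.
Variable x : nat -> A.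
Hypothesis x0 : x 0%N = 1.
Hypothesis xM : forall m n,
  x m * x n = iota 2^-1 * (x (m + n)%N + x ((m - n) + (n - m))%N).

Lemma x_comm m n : GRing.comm (x m) (x n).
Proof. by rewrite /GRing.comm !xM addnC [((m - n) + _)%N]addnC. Qed.

(** The functional calculus of the sequence [x] in degree at most [d], as a
    relation between functions and elements: this avoids carrying coefficients,
    and the induction principle gives every statement that is linear in the
    pair. *)
Inductive trigpoly (d : nat) : (R -> R) -> A -> Prop :=
| TrigMono (c : R) (n : nat) : (n <= d)%N ->
    trigpoly d (fun t => c * cos (n%:R * t)) (iota c * x n)
| TrigAdd f a g b : trigpoly d f a -> trigpoly d g b ->
    trigpoly d (fun t => f t + g t) (a + b).

Lemma trig_ext d f g a : trigpoly d f a -> f =1 g -> trigpoly d g a.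
Proof. by move=> H /funext <-. Qed.

Lemma trig_const d (c : R) : trigpoly d (fun=> c) (iota c).
Proof.
have := @TrigMono d c 0 (leq0n d); rewrite x0 mulr1 => /trig_ext; apply => t.
by rewrite mul0r cos0 mulr1.
Qed.

Lemma trig_cos n : trigpoly n (fun t => cos (n%:R * t)) (x n).
Proof.
have := @TrigMono n 1 n (leqnn n); rewrite rmorph1 mul1r => /trig_ext; apply => t.
by rewrite mul1r.
Qed.

Lemma trig_comm d e f g a b : trigpoly d f a -> trigpoly e g b -> GRing.comm a b.
Proof.
elim=> [c n _|f1 a1 g1 b1 _ IH1 _ IH2] H; last first.
  by apply/commr_sym/commrD; apply/commr_sym; [exact: IH1|exact: IH2].
elim: H => [c' m _|f1 a1 g1 b1 _ IH1 _ IH2]; last exact: commrD.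
apply: commrM; first exact/commr_sym/iotaC.
apply/commr_sym/commrM; first exact/commr_sym/iotaC.
exact: x_comm.
Qed.

Lemma trigM d e f g a b : trigpoly d f a -> trigpoly e g b ->
  trigpoly (d + e) (fun t => f t * g t) (a * b).
Proof.
elim=> [c n nd|f1 a1 g1 b1 _ IH1 _ IH2] H; last first.
  rewrite mulrDl; apply: (trig_ext (TrigAdd (IH1 H) (IH2 H))) => t.
  by rewrite mulrDl.
elim: H => [c' m me|f1 a1 g1 b1 _ IH1 _ IH2]; last first.
  rewrite mulrDr; apply: (trig_ext (TrigAdd IH1 IH2)) => t.
  by rewrite mulrDr.
have -> : iota c * x n * (iota c' * x m) = iota (c * c' / 2) * x (n + m)%N +
    iota (c * c' / 2) * x ((n - m) + (m - n))%N.
  rewrite -mulrDr !rmorphM -[RHS]mulrA -xM !mulrA; congr (_ * _).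
  by rewrite -!mulrA; congr (_ * _); rewrite iotaC.
have h1 : (n + m <= d + e)%N by lia.
have h2 : ((n - m) + (m - n) <= d + e)%N by lia.
apply: (trig_ext (TrigAdd (TrigMono _ h1) (TrigMono _ h2))) => t.
rewrite -mulrDr [RHS]mulrACA cosM_prod -mulrA; congr (_ * (_ * (_ + _))).
  by rewrite natrD mulrDl.
have [le|/ltnW le] := leqP n m.
  by rewrite (eqP le) add0n natrB// mulrBl -cosN opprB.
by rewrite (eqP le) addn0 natrB// mulrBl.
Qed.

Lemma trigX d f a k : trigpoly d f a ->
  trigpoly (d * k) (fun t => f t ^+ k) (a ^+ k).
Proof.
move=> H; elim: k => [|k IH].
  by rewrite muln0 expr0 -(rmorph1 iota); apply: (trig_ext (trig_const _ 1)).
rewrite mulnS exprS; apply: (trig_ext (trigM H IH)) => t.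
by rewrite exprS.
Qed.

(** The Dirichlet kernel centred at the [l]-th node, with [x j] in place of
    [cos (j t)]. *)
Definition dirichlet_kernel d (l : nat) : A :=
  \sum_(j < d.+1) iota (weight R j * cos (j%:R * node R d l)) * x j.

(** Both sides are linear in the pair, and on a monomial this is the orthogonality
    relation [cos_nodes_orth]. *)
Lemma trig_interpolation d f a : trigpoly d f a ->
  (2 * d).+1%:R * a = \sum_(l < (2 * d).+1) iota (f (node R d l)) * dirichlet_kernel d l.
Proof.
elim=> [c n nd|f1 a1 g1 b1 _ IH1 _ IH2]; last first.
  rewrite mulrDr IH1 IH2 -big_split/=; apply: eq_bigr => l _.
  by rewrite rmorphD mulrDl.
under eq_bigr => l _.
  rewrite /dirichlet_kernel mulr_sumr.
  under eq_bigr => j _ do rewrite mulrA -rmorphM.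
  over.
rewrite exchange_big/=.
under eq_bigr => j _.
  rewrite -mulr_suml -rmorph_sum.
  rewrite (eq_bigr (fun l : 'I_(2 * d).+1 => c * (weight R j *
    (cos (n%:R * node R d l) * cos (j%:R * node R d l))))); last by move=> l _; ring.
  rewrite -mulr_sumr cos_nodes_orth//; last by rewrite -ltnS.
  over.
have nd' : (n < d.+1)%N by [].
rewrite (bigD1 (Ordinal nd'))//= eqxx big1 ?addr0 => [|j jn]; last first.
  have -> : (j == n :> nat) = false by apply/negbTE.
  by rewrite mulr0 rmorph0 mul0r.
by rewrite mulrC rmorphM rmorph_nat mulrA.
Qed.

Variables (K : R).
Hypothesis NK : forall n, N (x n) <= K.

Lemma K_ge0 : 0 <= K.
Proof. exact: le_trans (N_ge0 (x 0)) (NK 0). Qed.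

Lemma trig_norm d f a s : trigpoly d f a -> (forall t, `|f t| <= s) ->
  N a <= 2 * K * d.+1%:R * s.
Proof.
move=> H fs; have K0 := K_ge0.
have Nk l : N (dirichlet_kernel d l) <= 2 * K * d.+1%:R.
  apply: le_trans (N_sum _ _) _.
  apply: (@le_trans _ _ (\sum_(j < d.+1) 2 * K)); last first.
    by rewrite sumr_const card_ord -[leLHS]mulr_natr.
  apply: ler_sum => j _; rewrite NZ ler_pM//; first exact: N_ge0.
  rewrite normrM -[leRHS]mulr1 ler_pM//; last exact: cos_max.
  by rewrite /weight; case: ifP => _; rewrite ger0_norm ?ler1n.
have n0 : 0 < (2 * d).+1%:R :> R by rewrite ltr0n.
rewrite -(ler_pM2l n0) -{1}(gtr0_norm n0) -NZ rmorph_nat (trig_interpolation H).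
apply: le_trans (N_sum _ _) _.
apply: (@le_trans _ _ (\sum_(j < (2 * d).+1) 2 * K * d.+1%:R * s)); last first.
  by rewrite sumr_const card_ord -[leLHS]mulr_natl.
by apply: ler_sum => j _; rewrite NZ mulrC ler_pM//; exact: N_ge0.
Qed.

(** The degree of [f ^ k] is linear in [k], hence negligible against the growth of
    [(r / s) ^ k]. *)
Lemma trig_power_bound d f a s r : trigpoly d f a -> (forall t, `|f t| <= s) ->
  s < r -> power_bound a r.
Proof.
move=> H fs sr; have K0 := K_ge0.
have s0 : 0 <= s := le_trans (normr_ge0 _) (fs 0).
(* An intermediate rate, positive even if [s = 0]. *)
pose q := (s + r) / 2; have q0 : 0 < q by rewrite /q; lra.
have qr : q < r by rewrite /q; lra.
pose h := r / q - 1; have h0 : 0 < h by rewrite /h subr_gt0 ltr_pdivlMr ?mul1r.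
exists (2 * K * (1 + d%:R / h)) => k.
have fq t : `|f t ^+ k| <= q ^+ k.
  rewrite normrX lerXn2r ?nnegrE ?(ltW q0)// (le_trans (fs t))// /q; lra.
apply: le_trans (trig_norm (trigX k H) fq) _.
rewrite -!mulrA !ler_wpM2l//.
have -> : r ^+ k = (1 + h) ^+ k * q ^+ k.
  by rewrite -exprMn /h addrC subrK divfK// gt_eqF.
rewrite mulrA ler_wpM2r ?exprn_ge0 ?(ltW q0)//.
apply: le_trans (_ : (1 + d%:R / h) * (1 + k%:R * h) <= _); last first.
  by rewrite ler_wpM2l ?bernoulli_one_add ?(ltW h0)// addr_ge0// divr_ge0// ltW.
rewrite -natr1 natrM.
have -> : (1 + d%:R / h) * (1 + k%:R * h) =
  d%:R * k%:R + 1 + d%:R / h + k%:R * h by field; rewrite gt_eqF.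
by rewrite -addrA lerDl addr_ge0// ?divr_ge0 ?mulr_ge0// ltW.
Qed.

Variable del : R.
Hypothesis del02 : 0 < del <= 2.
Hypothesis low : forall n z, (0 < n)%N -> del * N z <= N ((1 + x n) * z).

Lemma trig_power_bound_cancel d f a n j s r : trigpoly d f a -> (0 < n)%N ->
  (forall t, `|f t * (1 + cos (n%:R * t)) ^+ j| <= s) -> s < r * del ^+ j ->
  power_bound a r.
Proof.
move=> H n0 Hs sr.
have T1 : trigpoly n (fun t => 1 + cos (n%:R * t)) (1 + x n).
  rewrite -(rmorph1 iota); apply: TrigAdd; [exact: trig_const|exact: trig_cos].
have /andP[d0 _] := del02.
apply: (power_bound_cancel (g := 1 + x n) (d := del) (j := j)) => //.
- exact: trig_comm T1 H.
- by move=> z; exact: low.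
- exact: trig_power_bound (trigM H (trigX j T1)) Hs sr.
Qed.

Lemma trig_plateau L L' n : exists d U,
  trigpoly d (fun t => plateau L L' (cos (n%:R * t))) U.
Proof.
have T1 : trigpoly n (fun t => (1 - cos (n%:R * t)) / 2)
    ((1 + iota (-1) * x n) * iota 2^-1).
  have T0 : trigpoly n (fun t => 1 - cos (n%:R * t)) (1 + iota (-1) * x n).
    rewrite -{1}(rmorph1 iota).
    apply: (trig_ext (TrigAdd (trig_const n 1) (TrigMono (-1) (leqnn n)))) => t.
    by rewrite mulN1r.
  by have := trigM T0 (trig_const 0 2^-1); rewrite addn0.
have oneB d f a : trigpoly d f a ->
    trigpoly d (fun t => 1 - f t) (1 + iota (-1) * a).
  move=> H; rewrite -(rmorph1 iota); apply: TrigAdd; first exact: trig_const.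
  rewrite -[d]add0n.
  by apply: (trig_ext (trigM (trig_const 0 (-1)) H)) => t; rewrite mulN1r.
by have T := oneB _ _ _ (trigX L' (oneB _ _ _ (trigX L T1))); eexists; eexists; exact: T.
Qed.

(** The cut-offs are applied one frequency at a time, [q' = q * (1 - u)]. What is
    removed is [q * u], which is concentrated where [1 + cos (n t)] is small, so
    that each of the [m] steps costs at most [eta]. *)
Lemma cut_off_antipodes (eta : R) (Q : R -> R) d a m : 0 < eta -> trigpoly d Q a ->
  (forall t, 0 <= Q t <= 2) ->
  exists d' q b, [/\ trigpoly d' q b,
    (forall t, 0 <= q t <= Q t),
    (forall t n, (0 < n)%N -> (n <= m)%N -> 1 + cos (n%:R * t) <= del / 4 ->
       q t <= Q t / 4) &
    (forall r, 0 <= r -> power_bound b r -> power_bound a (r + m%:R * eta))].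
Proof.
move=> eta0 HQ Q2; have eta4 : 0 < eta / 4 by lra.
have [L [L' [j Hp]]] := plateauP del02 eta4.
elim: m => [|m [d' [q [b [Tq q0 qn Hr]]]]].
  exists d, Q, a; split => //.
  - by move=> t; rewrite lexx andbT; case/andP: (Q2 t).
  - by move=> t n n0; rewrite leqNgt n0.
  - by move=> r _; rewrite mul0r addr0.
have [dU [U TU]] := trig_plateau L L' m.+1.
pose u t : R := plateau L L' (cos (m.+1%:R * t)).
have cosI t : -1 <= cos (m.+1%:R * t :> R) <= 1 by rewrite cos_geN1 cos_le1.
have u01 t : 0 <= u t <= 1 by have [] := Hp _ (cosI t).
have TqU := trigM Tq TU.
have Tq' : trigpoly (d' + dU) (fun t => q t * (1 - u t)) (b * (1 + iota (-1) * U)).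
  apply: trigM => //; rewrite -(rmorph1 iota); apply: TrigAdd.
    exact: trig_const.
  rewrite -[dU]add0n.
  by apply: (trig_ext (trigM (trig_const 0 (-1)) TU)) => t; rewrite mulN1r.
exists (d' + dU)%N, (fun t => q t * (1 - u t)), (b * (1 + iota (-1) * U)).
split => //.
- move=> t; have /andP[q1 q2] := q0 t; have /andP[u1 u2] := u01 t.
  apply/andP; split; first by rewrite mulr_ge0// subr_ge0.
  by rewrite (le_trans _ q2)// -[leRHS]mulr1 ler_wpM2l//; lra.
- move=> t n n0 nm cn; have /andP[q1 q2] := q0 t; have /andP[u1 u2] := u01 t.
  move: nm; rewrite leq_eqVlt => /orP[/eqP nE|nm]; last first.
    apply: le_trans (qn t n n0 nm cn).
    by rewrite -[leRHS]mulr1 ler_wpM2l//; lra.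
  have [_ /(_ _) Hu _] := Hp _ (cosI t); rewrite nE in cn.
  have {}Hu := Hu cn; rewrite -/(u t) in Hu.
  by rewrite ler_pM// ?subr_ge0.
- move=> r r0 Hb.
  rewrite -natr1 mulrDl mul1r [_ + eta]addrC addrA; apply: Hr; first by lra.
  have -> : b = b * (1 + iota (-1) * U) + b * U.
    by rewrite mulrDr mulr1 rmorphN1 mulN1r mulrN subrK.
  apply: power_boundD => //; first exact: trig_comm Tq' TqU.
    exact: ltW.
  apply: (trig_power_bound_cancel (n := m.+1) (j := j) (s := eta / 2 * del ^+ j) TqU) => //.
    move=> t; have /andP[q1 q2] := q0 t; have /andP[u1 u2] := u01 t.
    have /andP[_ Q3] := Q2 t; have /andP[c1 c2] := cosI t.
    have cj : 0 <= (1 + cos (m.+1%:R * t)) ^+ j by rewrite exprn_ge0//; lra.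
    rewrite -/(u t) ger0_norm ?mulr_ge0// -mulrA.
    have [_ _] := Hp _ (cosI t); rewrite -/(u t) => H3.
    apply: (@le_trans _ _ (2 * (eta / 4 * del ^+ j))).
      by apply: ler_pM => //; [exact: mulr_ge0|exact: le_trans Q3].
    by rewrite le_eqVlt; apply/orP; left; apply/eqP; field.
  have dj : 0 < del ^+ j by rewrite exprn_gt0//; case/andP: del02.
  by rewrite ltr_pM2r//; lra.
Qed.

Lemma return_power_bound M m :
  (forall t : R, 1 - cos (M%:R * t) <= 2^-1 \/
    exists n : nat, [/\ (0 < n)%N, (n <= m)%N & 1 + cos (n%:R * t) <= del / 4]) ->
  power_bound (1 - x M) 1.
Proof.
move=> Hm; pose Q (t : R) := 1 - cos (M%:R * t).
have Q2 t : 0 <= Q t <= 2.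
  by rewrite /Q; have := cos_geN1 (M%:R * t); have := cos_le1 (M%:R * t); lra.
have TQ : trigpoly M Q (1 - x M).
  rewrite -[- x M]mulN1r -(rmorph1 iota) -(rmorphN iota).
  apply: (trig_ext (TrigAdd (trig_const M 1) (TrigMono (-1) (leqnn M)))) => t.
  by rewrite mulN1r.
pose eta : R := (4 * m.+1%:R)^-1.
have eta0 : 0 < eta by rewrite invr_gt0 mulr_gt0.
have [d [q [b [Tq q0 qn Hr]]]] := cut_off_antipodes m eta0 TQ Q2.
apply: (power_bound_le (r := 3 / 4 + m%:R * eta)).
  rewrite addr_ge0 ?mulr_ge0 ?(ltW eta0)//=.
  have : m%:R * eta <= m.+1%:R * eta by rewrite ler_wpM2r ?ler_nat// ltW.
  have -> : m.+1%:R * eta = 4^-1 by rewrite /eta invfM mulrCA mulfV ?mulr1 ?pnatr_eq0.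
  lra.
apply: Hr => //.
apply: (trig_power_bound (s := 2^-1) Tq); last lra.
move=> t; have /andP[q1 q2] := q0 t; rewrite ger0_norm//.
have [H|[n [n0 nm cn]]] := Hm t; first exact: le_trans q2 H.
by have := qn t n n0 nm cn; have := Q2 t; lra.
Qed.

End CosineSequence.

(** * Cosine families close to the identity *)

Section CosineFamily.
Variable C : R -> A.
Hypothesis C0 : C 0 = 1.
Hypothesis CD : forall s t, C (t + s) + C (t - s) = C t * C s *+ 2.

Lemma cosine_even t : C (- t) = C t.
Proof.
have := CD t 0; rewrite add0r sub0r C0 mul1r mulr2n => /addrI; exact.
Qed.

Lemma cosine_prod s t : C t * C s = iota 2^-1 * (C (t + s) + C (t - s)).
Proof. by rewrite CD -[C t * C s *+ 2]mulr_natl mulrA iotaK2 mul1r. Qed.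

Variables (c T : R).
Hypothesis c2 : c < 2.
Hypothesis near1 : forall t, T <= t -> N (C t - 1) <= c.

Lemma c_ge0 : 0 <= c.
Proof. exact: le_trans (N_ge0 _) (near1 (lexx T)). Qed.

Lemma one_add_cosine_lower t z : T <= t -> (2 - c) * N z <= N ((1 + C t) * z).
Proof.
move=> /near1 Nt.
have E : (1 + C t) * z - (C t - 1) * z = z *+ 2.
  by rewrite -mulrBl opprB addrACA subrr addr0 mulrDl mul1r mulr2n.
have N2 : N (z *+ 2) = 2 * N z.
  by rewrite -[z *+ 2]mulr_natl -(rmorph_nat iota) NZ ger0_norm.
have := ND ((1 + C t) * z) (- ((C t - 1) * z)); rewrite NN E N2.
have := NM (C t - 1) z; have : N (C t - 1) * N z <= c * N z.
  by rewrite ler_wpM2r// N_ge0.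
lra.
Qed.

(** The constants of [return_or_antipode] depend on the gap [2 - c] only, which
    makes [M] independent of [t]. *)
Lemma cosine_return : exists2 M, (0 < M)%N &
  forall t, 0 <= t -> T <= t -> power_bound (1 - C (M%:R * t)) 1.
Proof.
have c0 := c_ge0.
have del02 : 0 < 2 - c <= 2 by rewrite subr_gt0 c2 lerBlDr lerDl.
have [|M M0 [m Hm]] := @return_or_antipode R ((2 - c) / 4).
  by rewrite divr_gt0 ?subr_gt0.
exists M => // t t0 Tt; pose x n := C (n%:R * t).
have Tn n : (0 < n)%N -> T <= n%:R * t.
  by move=> n0; rewrite (le_trans Tt)// ler_peMl// ler1n.
apply: (@return_power_bound x _ _ (N 1 + c) _ (2 - c) del02 _ M m) => //.
- by rewrite /x mul0r.
- move=> n k; rewrite /x cosine_prod natrD mulrDl -mulrBl; congr (_ * (_ + _)).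
  have [le|/ltnW le] := leqP n k.
    by rewrite (eqP le) add0n natrB// -cosine_even -mulNr opprB.
  by rewrite (eqP le) addn0 natrB.
- case=> [|n]; first by rewrite /x mul0r C0 lerDl.
  rewrite /x -[C _](subrK 1) addrC (le_trans (ND _ _))// lerD2l near1//.
  exact: Tn.
- by move=> n z n0; apply: one_add_cosine_lower; exact: Tn.
Qed.

(** The bound [N (1 - C s) <= N (1 - C (2 * s)) / 2] holds on a half-line, which is
    stable under doubling, so it can be iterated. *)
Theorem cosine_trivial t : C t = 1.
Proof.
have [M M0 HM] := cosine_return; have c0 := c_ge0.
have MR : 0 < M%:R :> R by rewrite ltr0n.
pose S := M%:R * Num.max T 0.
have S0 : 0 <= S by rewrite mulr_ge0 ?(ltW MR)// le_max lexx orbT.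
have TS : T <= S.
  have h : T <= Num.max T 0 by rewrite le_max lexx.
  by rewrite (le_trans h)// ler_peMl ?ler1n// le_max lexx orbT.
have PS s : S <= s -> power_bound (1 - C s) 1.
  move=> Ss; rewrite -[s](mulfVK (lt0r_neq0 MR)) mulrC.
  have : Num.max T 0 <= s / M%:R by rewrite ler_pdivlMr// mulrC.
  by rewrite ge_max => /andP[h1 h2]; exact: HM.
have decay k : forall s, S <= s -> N (1 - C s) <= c * 2^-1 ^+ k.
  elim: k => [|k IH] s Ss.
    by rewrite expr0 mulr1 -NN opprB near1// (le_trans TS).
  apply: (logistic_contract (PS _ Ss)); last first.
    have : 2^-1 ^+ k.+1 <= 2^-1 :> R.
      by rewrite exprS ler_piMr ?invr_ge0// exprn_ile1 ?invr_ge0// invf_le1// ler1n.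
    move=> h; apply: (@le_lt_trans _ _ (c * 2^-1)); last by (have c2' : c < 2 := c2); lra.
    by rewrite ler_wpM2l.
  have -> : (1 - C s) *+ 2 - (1 - C s) ^+ 2 = iota 2^-1 * (1 - C (s + s)).
    have CC : C (s + s) = C s ^+ 2 *+ 2 - 1.
      by rewrite expr2 -CD subrr C0 addrK.
    have -> : 1 - C (s + s) = 2%:R * (1 - C s ^+ 2).
      by rewrite CC mulr_natl mulrnBl opprB addrA -mulr2n.
    rewrite mulrA iotaK2 mul1r expr2 -mulr_natr -mulrBr.
    have -> : 2%:R - (1 - C s) = 1 + C s.
      by rewrite opprB addrCA -[2%:R]/(1 + 1) addrK addrC.
    by rewrite mulrDr mulr1 mulrBl mul1r -expr2 addrA subrK.
  rewrite NZ ger0_norm ?invr_ge0// exprS mulrCA ler_wpM2l ?invr_ge0//.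
  by apply: IH; lra.
have one s : S <= s -> C s = 1.
  move=> Ss; apply/eqP; rewrite eq_sym -subr_eq0; apply/eqP/N_eq0/le_anti.
  rewrite N_ge0 andbT; apply/ler_addgt0Pr => e e0; rewrite add0r.
  have [k ke] : exists k, (2^-1 : R) ^+ k <= e / 2.
    by apply: expr_small; lra.
  apply: le_trans (decay k s Ss) _.
  apply: (@le_trans _ _ (2 * (e / 2))); last lra.
  by rewrite ler_pM// ?exprn_ge0 ?invr_ge0// ltW.
(* [t] is the difference of two points of the half-line on which [C] is known. *)
pose s := S + `|t|; have Ss : S <= s by rewrite lerDl.
have st : S <= s + t.
  by rewrite -addrA lerDl -lerBlDr sub0r -normrN ler_norm.
have := CD s (s + t); rewrite (one _ Ss) (one _ st) mul1r.
have -> : s + t - s = t by rewrite addrAC subrr add0r.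
rewrite (one (s + t + s)); last by rewrite (le_trans st)// lerDl (le_trans S0).
by rewrite mulr2n => /addrI.
Qed.

End CosineFamily.

End NormedRing.

Lemma limf_esup_lt_eventually (R : realType) (g : R -> R) (b : R) :
  (forall t, 0 <= g t) ->
  (limf_esup (fun t => (g t)%:E) (pinfty_nbhs R) < b%:E)%E ->
  exists c T, c < b /\ forall t, T <= t -> g t <= c.
Proof.
move=> g0 /ereal_inf_lt[_ [V [M [Mr MV]] <-]].
set s := ereal_sup _ => s2.
have gs t : M < t -> ((g t)%:E <= s)%E.
  by move=> Mt; apply: ereal_sup_ubound; exists t => //; exact: MV.
have M1 : M < M + 1 by rewrite ltrDl.
have sfin : s \is a fin_num.
  rewrite fin_numE; apply/andP; split; apply/eqP => sE.
    by have := gs _ M1; rewrite sE.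
  by rewrite sE in s2.
exists (fine s), (M + 1); split; first by rewrite -lte_fin fineK.
by move=> t Mt; rewrite -lee_fin fineK// gs// (lt_le_trans M1).
Qed.

(** * Banach algebras *)

Definition ring_of (K : numFieldType) (A : banachAlgType K) : Type := A.

HB.instance Definition _ K (A : banachAlgType K) :=
  GRing.Zmodule.copy (ring_of A) A.
HB.instance Definition _ K (A : banachAlgType K) :=
  GRing.Zmodule_isPzRing.Build (ring_of A) (@bmulA K A) (@bmul1l K A)
    (@bmul1r K A) (@bmulDl K A) (@bmulDr K A).

Definition scalar_of (R : realType) (K : numFieldType) (em : {rmorphism R -> K})
  (A : banachAlgType K) (r : R) : ring_of A := em r *: (bone : A).

Section Scalars.
Variables (R : realType) (K : numFieldType) (em : {rmorphism R -> K}).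
Variable A : banachAlgType K.

Lemma scalar_ofM r (a : ring_of A) : scalar_of em A r * a = em r *: (a : A).
Proof. by rewrite -[LHS]/(bmul _ _) -bscaleAl bmul1l. Qed.

Fact scalar_of_additive : zmod_morphism (scalar_of em A).
Proof. by move=> r s; rewrite /scalar_of rmorphB scalerBl. Qed.
HB.instance Definition _ :=
  GRing.isZmodMorphism.Build R (ring_of A) (scalar_of em A) scalar_of_additive.

Fact scalar_of_multiplicative : monoid_morphism (scalar_of em A).
Proof.
split; first by rewrite /scalar_of rmorph1 scale1r.
by move=> r s; rewrite scalar_ofM /scalar_of rmorphM scalerA.
Qed.
HB.instance Definition _ :=
  GRing.isMonoidMorphism.Build R (ring_of A) (scalar_of em A)
    scalar_of_multiplicative.

Variable re : K -> R.
Hypothesis em_le : {mono em : r s / r <= s}.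
Hypothesis em_norm : forall r, `|em r| = em `|r|.
Hypothesis reK : forall z, 0 <= z -> em (re z) = z.

(** The pair [em], [re] identifies [R] with the part of [K] in which norms take
    their values. *)
Lemma banach_cosine_trivial (C : R -> A) : cosine_family C ->
  (limf_esup (fun t : R => (re `|C t - bone|)%:E) (pinfty_nbhs R) < 2%:E)%E ->
  forall t, C t = bone.
Proof.
move=> [C0 CD]; pose N (a : ring_of A) := re `|(a : A)|.
have emN a : em (N a) = `|(a : A)| by rewrite reK.
move=> /limf_esup_lt_eventually[t|c [T [c2 cT]]].
  by rewrite -em_le rmorph0 reK.
apply: (@cosine_trivial R (ring_of A) (scalar_of em A) N _ _ _ _ _ C C0 _ c T c2 cT).
- move=> r a; rewrite scalar_ofM.
  by rewrite -[RHS]/(bmul _ _) -bscaleAr bmul1r.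
- by move=> a b; rewrite -em_le rmorphD !emN; exact: ler_normD.
- by move=> a b; rewrite -em_le rmorphM !emN; exact: normr_bmul_le.
- move=> r a; apply: (inc_inj em_le).
  by rewrite rmorphM !emN scalar_ofM normrZ em_norm.
- by move=> a Na; apply/eqP; rewrite -[_ == _]normr_eq0 -emN Na rmorph0.
- by move=> s t; rewrite CD scaler_nat.
Qed.

End Scalars.

Theorem theorem2p5 (R : realType) :
  (forall (A : banachAlgType R) (C : R -> A),
     cosine_family C ->
     (limf_esup (fun t : R => (`|C t - bone|)%:E) (pinfty_nbhs R) < 2%:E)%E ->
     forall t : R, C t = bone)
  /\
  (forall (A : banachAlgType R[i]) (C : R -> A),
     cosine_family C ->
     (limf_esup (fun t : R => (complex.Re `|C t - bone|)%:E) (pinfty_nbhs R) < 2%:E)%E ->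
     forall t : R, C t = bone).
Proof.
split=> A C.
  exact: (@banach_cosine_trivial R R idfun A idfun).
apply: (@banach_cosine_trivial R R[i] (real_complex R) A (@complex.Re R)).
- by move=> r s; rewrite lecR.
- by move=> r; rewrite normc_def /= expr0n addr0 sqrtr_sqr.
- by move=> z z0; exact: RRe_real (ger0_real z0).
Qed.
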